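(* Let $\alpha=(\alpha_1,\dots,\alpha_m)$ be a ribbon with $m\ge 3$ and $\alpha_k\ge 2$ for all $k$, and set $\alpha_0=\infty$. Suppose that for some $1\le i\le m-1$ we have $\alpha_i>\alpha_{i+1}$ and $\alpha_i<\alpha_{i-1}+\alpha_{i+1}$. Then $[\alpha]\subseteq[\alpha_{(i\ i+1)}]$.
   Context: A composition $\alpha=(\alpha_1,\dots,\alpha_m)$ determines the ribbon (connected skew shape with no $2\times2$ block) with $m$ rows whose $i$-th row from the top has $\alpha_i$ boxes, the leftmost box of row $i$ lying directly above the rightmost box of row $i+1$. $\alpha_{(i\ i+1)}$ denotes the ribbon whose row-length sequence is $\alpha$ with the $i$-th and $(i+1)$-st entries swapped. For a skew shape $\lambda/\mu$ with Schur expansion $s_{\lambda/\mu}=\sum_\nu c^\lambda_{\mu,\nu}s_\nu$, the Schur support is $[\lambda/\mu]=\{\nu: c^\lambda_{\mu,\nu}>0\}$; by the Littlewood–Richardson rule, $\nu\in[\lambda/\mu]$ iff there is a tableau of shape $\lambda/\mu$ and content $\nu$ that is semistandard (rows weakly increasing, columns strictly increasing) and whose reverse reading word (rows read right to left, top to bottom) is Yamanouchi (every prefix has at least as many $k$'s as $(k+1)$'s for all $k$). *)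

(* Defs.v *)
From mathcomp Require Import all_boot.
Set Implicit Arguments. Unset Strict Implicit. Unset Printing Implicit Defensive.

(* Skew shapes lam/mu in English notation: rows indexed from 0 (top),
   columns from 0 (left); cell (r,c) belongs to lam/mu iff mu_r <= c < lam_r. *)
Definition in_skew (lam mu : seq nat) (r c : nat) : bool :=
  (nth 0 mu r <= c) && (c < nth 0 lam r).

Definition semistandard (lam mu : seq nat) (T : nat -> nat -> nat) : Prop :=
  (forall r c, in_skew lam mu r c -> 0 < T r c) /\
  (forall r c, in_skew lam mu r c -> in_skew lam mu r c.+1 -> T r c <= T r c.+1) /\
  (forall r c, in_skew lam mu r c -> in_skew lam mu r.+1 c -> T r c < T r.+1 c).

Definition rev_reading_word (lam mu : seq nat) (T : nat -> nat -> nat) : seq nat :=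
  flatten [seq [seq T r c | c <- rev (iota (nth 0 mu r) (nth 0 lam r - nth 0 mu r))]
          | r <- iota 0 (size lam)].

Definition yamanouchi (w : seq nat) : Prop :=
  forall n k, 0 < k -> count_mem k.+1 (take n w) <= count_mem k (take n w).

Definition is_partition (nu : seq nat) : bool :=
  sorted geq nu && all (fun x => 0 < x) nu.

Definition has_content (w nu : seq nat) : Prop :=
  forall k, count_mem k.+1 w = nth 0 nu k.

(* Schur support [lam/mu], via the Littlewood-Richardson rule. *)
Definition schur_support (lam mu nu : seq nat) : Prop :=
  is_partition nu /\
  exists T : nat -> nat -> nat,
    semistandard lam mu T /\
    has_content (rev_reading_word lam mu T) nu /\
    yamanouchi (rev_reading_word lam mu T).

(* Ribbon of a composition alpha (row lengths top to bottom, 0-indexed rows):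
   the leftmost box of row i lies directly above the rightmost box of row i+1.
   Row i occupies columns sum_{j>i}(alpha_j - 1) .. sum_{j>=i} alpha_j - (m-1-i) - 1. *)
Definition ribbon_outer (alpha : seq nat) : seq nat :=
  [seq sumn (drop i alpha) - (size alpha - i.+1) | i <- iota 0 (size alpha)].
Definition ribbon_inner (alpha : seq nat) : seq nat :=
  [seq sumn (drop i.+1 alpha) - (size alpha - i.+1) | i <- iota 0 (size alpha)].

Definition ribbon_support (alpha nu : seq nat) : Prop :=
  schur_support (ribbon_outer alpha) (ribbon_inner alpha) nu.

(* alpha_(i i+1) with 1-indexed i: swap entries at 0-indexed positions i-1 and i. *)
Definition swap_adj (alpha : seq nat) (i : nat) : seq nat :=
  set_nth 0 (set_nth 0 alpha i.-1 (nth 0 alpha i)) i (nth 0 alpha i.-1).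

(* Main.v *)
(* Reading the rows of an LR filling of a ribbon one after the other gives a chain
   of partitions, starting from the empty one, whose successive differences are
   horizontal strips of sizes alpha_1, ..., alpha_m; the columns of length 2 say
   that each strip has a cell strictly below some cell of the preceding strip.
   Conversely every such chain comes from an LR filling.

   To exchange the strips of sizes a > b in f < g < h, replace g by a smaller
   middle shape of size |f| + b. This works unless all b cells of h / g lie right
   below cells of g / f and these are all weakly above the topmost row x of the
   preceding strip, so that a smaller middle shape has no cell below row x.
   Then f has to change as well. If one of the vertical dominoes of h / f starts
   in a row r < x, trade a cell of f in row x for one in row r. Otherwise all
   dominoes start in row x; the hypothesis a < alpha_(i-1) + b gives the preceding
   strip a cell in some row t > x, which is traded for a cell in row x. This may
   force the same kind of trade in the earlier strips, see [raise_cell]. *)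
Require Import Defs.
From mathcomp Require Import all_boot zify.
Set Implicit Arguments. Unset Strict Implicit. Unset Printing Implicit Defensive.

(** * Row-length functions and their sizes *)

Section Chains.
Variable N : nat.
Implicit Types (f g h : nat -> nat) (k l x y z t n a b c : nat) (p q : seq nat).

Definition weight f := \sum_(k < N) f k.

Lemma weight_le f g : (forall k, f k <= g k) -> weight f <= weight g.
Proof. by move=> fg; apply: leq_sum. Qed.

Lemma weight_lt f g x :
  (forall k, f k <= g k) -> x < N -> f x < g x -> weight f < weight g.
Proof.
move=> fg xN fgx; rewrite /weight (bigD1 (Ordinal xN)) //= [ltnRHS](bigD1 (Ordinal xN)) //=.
by rewrite -addSn leq_add // leq_sum.
Qed.

Lemma weight_ltP f g : weight f < weight g -> exists2 k, k < N & f k < g k.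
Proof.
move=> fg; case: (boolP [exists k : 'I_N, f k < g k]) => [/existsP[k fgk]|].
  by exists k.
rewrite negb_exists => /forallP gf; move: fg; rewrite ltnNge leq_sum // => k _.
by rewrite leqNgt gf.
Qed.

Lemma weight_add f g : weight (fun k => f k + g k) = weight f + weight g.
Proof. exact: big_split. Qed.

Lemma weight_pulse x n : x < N -> weight (fun k => (k == x) * n) = n.
Proof.
move=> xN; rewrite /weight (bigD1 (Ordinal xN)) //= eqxx mul1n big1 ?addn0 // => k.
by rewrite -val_eqE /= => /negPf ->.
Qed.

Lemma weight_pulse_le x n : weight (fun k => (k == x) * n) <= n.
Proof.
case: (ltnP x N) => [/weight_pulse -> //|Nx]; rewrite /weight big1 // => k _.
by rewrite (_ : _ == _ = false) //; apply/eqP; have := ltn_ord k; lia.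
Qed.

Lemma weight_shift f : f N = 0 -> weight (fun k => f k.+1) <= weight f.
Proof.
move=> fN; have E := @big_ord_recr nat 0 addn N (fun i => f i).
rewrite big_ord_recl /= fN addn0 in E.
by rewrite /weight -E leq_addl.
Qed.

Lemma weight_between n f g :
  (forall k, f k <= g k) -> weight f <= n <= weight g ->
  exists h, [/\ forall k, f k <= h k, forall k, h k <= g k & weight h = n].
Proof.
move=> fg /andP[fn ng].
move: {2}(n - weight f) (erefl (n - weight f)) => d.
elim: d f fg fn => [|d IH] f fg fn dE.
  by exists f; split=> //; lia.
have [|k kN fgk] := @weight_ltP f g; first by lia.
have wE : weight (fun j => f j + (j == k) * 1) = (weight f).+1.
  by rewrite weight_add weight_pulse // addn1.
have [|||h [h1 h2 h3]] := IH (fun j => f j + (j == k) * 1).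
- by move=> j; have := fg j; case: eqP => [->|]; lia.
- by lia.
- by lia.
by exists h; split=> // j; have := h1 j; lia.
Qed.

(** * Cell moves, horizontal strips and chains *)

Definition move_cell f x t := fun k => f k + (k == x) - (k == t).

Lemma weight_move f x t :
  x < N -> t < N -> x != t -> 0 < f t -> weight (move_cell f x t) = weight f.
Proof.
move=> xN tN xt ft.
have: weight (fun k => move_cell f x t k + (k == t) * 1) =
      weight (fun k => f k + (k == x) * 1).
  apply: eq_bigr => k _; rewrite /move_cell.
  by case: ((k : nat) =P t) => [->|]; lia.
by rewrite !weight_add !weight_pulse //; lia.
Qed.

(** No separate partition clause is needed: [g k.+1 <= f k <= g k] makes [g] weakly decreasing, and
    [f k.+1 <= g k.+1 <= f k] does so for [f]. *)
Definition hstrip f g := forall k, f k <= g k /\ g k.+1 <= f k.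

(* [step a f y g z]: the strip [g / f] has size [a]; rows are counted from 0, so
   [y <= l] says that row [l] lies strictly below row [y.-1], a row of the
   preceding strip, and [z.-1] is a row of the new strip ([y = 0]: no
   preceding strip). *)
Definition step a f y g z :=
  [/\ hstrip f g, forall k, N <= k -> g k = 0, weight g = weight f + a,
      exists2 l, y <= l & f l < g l & exists2 x, z = x.+1 & f x < g x].

Fixpoint run p f y g z :=
  if p is a :: p' then exists h w, step a f y h w /\ run p' h w g z
  else f = g /\ y = z.

Lemma run_cat p q f y g z :
  run (p ++ q) f y g z <-> exists h w, run p f y h w /\ run q h w g z.
Proof.
elim: p f y => [|a p IH] f y /=.
  by split=> [r|[h [w [[-> ->]]]]] //; exists f, y.
split=> [[h [w [s /IH[h' [w' [r1 r2]]]]]]|[h' [w' [[h [w [s r1]]] r2]]]].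
  by exists h', w'; split=> //; exists h, w.
by exists h, w; split=> //; apply/IH; exists h', w'.
Qed.

Lemma run_rcons p a f y g z :
  run (rcons p a) f y g z <-> exists h w, run p f y h w /\ step a h w g z.
Proof.
rewrite -cats1 run_cat; split=> [[h [w [r /= [h' [w' [s [<- <-]]]]]]]|[h [w [r s]]]].
  by exists h, w.
by exists h, w; split=> //=; exists g, z.
Qed.

(** * Trading a cell for one higher up *)

Lemma lt_supp f g k : (forall j, N <= j -> g j = 0) -> f k < g k -> k < N.
Proof. by move=> g0; rewrite ltnNge; case: leqP => // /g0 ->. Qed.

(** Row [x] holds fewer than [c] cells of the strip and the rows above it none, so some cell lies
    below; [t] is the topmost such row. If the trade breaks the lower bound [y], the strip was one
    cell in row [t] and all others in row [x]. *)
Lemma raise_cell_strip f y g c x :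
  2 <= c -> hstrip f g -> (forall k, N <= k -> g k = 0) -> weight g = weight f + c ->
  (exists2 l, y <= l & f l < g l) ->
  (forall k, k < x -> f k = g k) -> (forall k, k.+1 = x -> g x < g k) ->
  g x < f x + c ->
  exists t, let h := move_cell g x t in
  [/\ x < t, f t < g t,
      [/\ hstrip f h, weight h = weight g & forall k, N <= k -> h k = 0],
      f x < h x &
      (exists2 l, y <= l & f l < h l) \/
      [/\ x < y, forall k, x < k -> k <> t -> f k = g k, g t = (f t).+1 & c = (g x - f x).+1]].
Proof.
move=> c2 fg g0 wg [l0 yl0 fgl0] fgx room gx.
have ex : exists t, (x < t) && (f t < g t).
  have [|k _ kP] := @weight_ltP (fun k => f k + (k == x) * (g x - f x)) g.
    by rewrite weight_add wg; have := weight_pulse_le x (g x - f x); lia.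
  exists k; have [fgk _] := fg k; have [fgx' _] := fg x.
  by case: (ltngtP k x) kP => [/fgx->|_|->]; lia.
case: (ex_minnP ex) => t /andP[xt fgt] tmin.
have tN := lt_supp g0 fgt.
have fxh : f x < move_cell g x t x.
  by have [fgx' _] := fg x; rewrite /move_cell eqxx; case: eqP; lia.
exists t; split=> //.
- split.
  + move=> k; have [fgk gfk] := fg k; rewrite /move_cell; split.
      by case: (k =P t) => [->|]; lia.
    case: (k.+1 =P x) => [kx|]; last by lia.
    have := room _ kx; rewrite -kx; have := fgx k; lia.
  + by apply: weight_move; lia.
  + by move=> k Nk; rewrite /move_cell g0 //; case: eqP; lia.
case: (leqP y x) => [yx|xy]; first by left; exists x.
case: (leqP y t) => [yt|ty]; last first.
  left; exists l0 => //; rewrite /move_cell; case: (l0 =P t); lia.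
have [more|one] := boolP [exists l : 'I_N, (y <= l) && (f l < move_cell g x t l)].
  by left; case/existsP: more => l /andP[? ?]; exists l.
right.
have {}one l : y <= l -> move_cell g x t l <= f l.
  move=> yl; case: (ltnP l N) => [lN|Nl].
    move: one; rewrite negb_exists => /forallP/(_ (Ordinal lN)) /=.
    by rewrite yl /= -leqNgt.
  by rewrite /move_cell g0 //; case: eqP; lia.
have gt : g t = (f t).+1.
  by have := one _ yt; rewrite /move_cell eqxx; case: eqP; lia.
have out k : x < k -> k <> t -> f k = g k.
  move=> xk kt; have [fgk _] := fg k; apply/eqP; rewrite eqn_leq fgk /= leqNgt.
  apply/negP => fgk'; have tk : t <= k by apply: tmin; rewrite xk.
  have := one k; rewrite /move_cell; case: (k =P x); case: (k =P t); lia.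
split=> //.
suff: weight g <= weight f + ((g x - f x) + 1) by lia.
rewrite -(@weight_pulse x (g x - f x)) ?(ltn_trans xt) // -(@weight_pulse t 1) //.
rewrite -!weight_add; apply: weight_le => k.
case: (ltngtP k x) => [/fgx->|xk|->]; try lia.
by case: (k =P t) => [->|/(out _ xk)->]; lia.
Qed.

(* The cell in the topmost row [t > x] of the last strip is traded for a new cell
   in row [x]. Only the lower bound [y] of the last strip can fail, when row [t]
   was the only row of the strip from [y] on; then the same trade is first made
   on the preceding strip, which allows replacing [y] by [x.+1]. *)
Lemma raise_cell p f y g c x :
  all (leq 2) p -> run p (fun=> 0) 0 f y -> 2 <= c ->
  hstrip f g -> (forall k, N <= k -> g k = 0) -> weight g = weight f + c ->
  (exists2 l, y <= l & f l < g l) ->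
  (forall k, k < x -> f k = g k) -> (forall k, k.+1 = x -> g x < g k) ->
  g x < f x + c -> (c = (g x - f x).+1 -> f x <= g x.+1) ->
  exists t, [/\ x < t, f t < g t &
              run (rcons p c) (fun=> 0) 0 (move_cell g x t) x.+1].
Proof.
elim/last_ind: p f y g c => [|p e IH] f y g c p2 rp c2 fg g0 wg low fgx room gx gx1.
all: have [t [xt fgt [fh wh h0] fhx]] := raise_cell_strip c2 fg g0 wg low fgx room gx.
all: have stepE z k : f k < move_cell g x t k ->
    (exists2 l, z <= l & f l < move_cell g x t l) ->
    step c f z (move_cell g x t) k.+1.
all: try by split=> //; [rewrite wh | exists k].
all: move=> [low'|[xy out gt cE]].
all: try by exists t; split=> //; apply/run_rcons; exists f, y; split=> //; apply: stepE.
  by case: rp xy => _ <-.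
move: (rp) => /run_rcons[o [y1 [ro [of_ f0 wf lowf [x0 yx0 ofx0]]]]].
have /andP[e2 {}p2] : (2 <= e) && all (leq 2) p by move: p2; rewrite all_rcons.
(* If the preceding strip has a cell in a row [k < x], then [k.+1] can replace [y], and row [x]
   itself meets this bound. *)
have [/existsP[k ofk]|above] := boolP [exists k : 'I_x, o k < f k].
  exists t; split=> //; apply/run_rcons; exists f, k.+1; split; last first.
    by apply: stepE => //; exists x.
  by apply/run_rcons; exists o, y1; split=> //; split=> //; exists k.
have {}above k : k < x -> o k = f k.
  move=> kx; move: above; rewrite negb_exists => /forallP/(_ (Ordinal kx)) /=.
  by have [] := of_ k; lia.
(* With [f x.+1 <= o x] and [2 <= e], this gives the last two hypotheses of the induction for the
   strip [f / o]. *)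
have fx1 : f x <= (f x.+1).+1.
  by have := gx1 cE; case: (x.+1 =P t) => [->|]; [lia|move=> /out <- //; lia].
have fltx : f x < g x by lia.
have [|||s [xs ofs rs]] := IH _ _ _ _ p2 ro e2 of_ f0 wf lowf above.
- by move=> k kx; rewrite (fgx k) ?(ltn_trans fltx) ?room //; lia.
- by have [] := of_ x; lia.
- by have [] := of_ x; lia.
(* Both shapes gain a cell in row [x]; the cell that [f] loses in row [s > x] gives the last strip a
   cell below row [x]. *)
exists t; split=> //; apply/run_rcons; exists (move_cell f x s), x.+1; split=> //.
have sN := lt_supp f0 ofs.
have fs : forall k, k = s -> f k <= g k - (k == t).
  by move=> k ->; case: eqP => [->|]; have [] := fg s; lia.
split=> //.
- move=> k; have [fgk gfk] := fg k; have [fhk hfk] := fh k; split.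
    rewrite /move_cell; have := fs k; case: (k =P s); case: (k =P x); case: (k =P t) => /=; try lia.
    by move=> ->; lia.
  rewrite {2}/move_cell; case: (k =P s) => [->|]; last by lia.
  have [_ fos] := of_ s; rewrite /move_cell.
  by case: (s.+1 =P t) => [st|/(out s.+1)]; [move: gt; rewrite -st|]; lia.
- rewrite wh wg (@weight_move f) //; lia.
- exists s => //; rewrite /move_cell eqxx.
  by have := fs s erefl; case: (s =P x); case: (s =P t); lia.
- exists x => //; rewrite /move_cell eqxx; case: eqP; case: eqP; lia.
Qed.

(** * Exchanging two consecutive strips *)

Lemma step_row a f y g z k : step a f y g z -> f k < g k -> step a f y g k.+1.
Proof. by case=> ? ? ? ? _ fgk; split=> //; exists k. Qed.

Lemma step_low a f y y' g z : step a f y g z -> y' <= y -> step a f y' g z.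
Proof.
by case=> ? ? ? [l yl fgl] ? y'y; split=> //; exists l => //; apply: leq_trans yl.
Qed.

(* The smallest g such that g / f and h / g are both horizontal strips. *)
Definition minimal_middle f h := fun k => maxn (f k) (h k.+1).

Lemma minimal_middle_le f g h k :
  hstrip f g -> hstrip g h -> minimal_middle f h k <= g k.
Proof. by move=> /(_ k)[fg _] /(_ k)[_ hg]; rewrite geq_max fg. Qed.

Lemma hstrip_middle f g h g' : hstrip f g -> hstrip g h ->
  (forall k, minimal_middle f h k <= g' k) -> (forall k, g' k <= g k) ->
  hstrip f g' /\ hstrip g' h.
Proof.
move=> fg gh lo up; split=> k.
  by have := lo k; have := up k.+1; have [] := fg k; rewrite geq_max => ? ? ? /andP[]; lia.
by have := lo k; have := up k; have [] := gh k; rewrite geq_max => ? ? ? /andP[]; lia.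
Qed.

(** Row [k] of the minimal middle exceeds [f k] by at most the number of cells of [h / g] in row
    [k.+1], because [g k.+1 <= f k]. Summing gives the bound; equality forbids [g k.+1 < f k]
    wherever row [k.+1] has such a cell. *)
Lemma weight_minimal_middle f g h a b :
  hstrip f g -> hstrip g h -> (forall k, N <= k -> h k = 0) ->
  weight h = weight g + b ->
  weight (minimal_middle f h) <= weight f + b /\
  (weight (minimal_middle f h) = weight f + b ->
   forall k, g k.+1 < h k.+1 -> g k.+1 = f k).
Proof.
move=> fg gh h0 wh.
pose u k := h k - g k.
have wu : weight u = b.
  suff : weight (fun k => g k + u k) = weight h by rewrite weight_add wh; lia.
  by apply: eq_bigr => k _; rewrite /u; have [] := gh k; lia.
have lou k : minimal_middle f h k <= f k + u k.+1.
  by rewrite /minimal_middle /u; have [? ?] := fg k; have [? ?] := gh k.+1; lia.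
have bnd : weight (fun k => f k + u k.+1) <= weight f + b.
  by rewrite weight_add -wu leq_add2l weight_shift // /u h0.
split; first exact: leq_trans (weight_le lou) bnd.
move=> wlo k ghk; apply/eqP; rewrite eqn_leq (proj2 (fg k)) leqNgt; apply/negP => gf.
have kN := lt_supp h0 ghk.
suff : weight (minimal_middle f h) < weight (fun k => f k + u k.+1) by lia.
by apply: (@weight_lt _ _ k) => //; rewrite /minimal_middle /u; lia.
Qed.

(** A new middle shape must add a cell to [f] from row [y] on, and leave a cell of [h] below some
    added cell. Cells forced by [minimal_middle] settle the second demand; the first fails only if
    they use up all [b] cells and lie above row [y]. *)
Lemma exchange_or_tight a b f y g w h z :
  step a f y g w -> step b g w h z -> 2 <= b <= a ->
  (exists g' w', step b f y g' w' /\ step a g' w' h z) \/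
  weight (minimal_middle f h) = weight f + b /\
  forall k, y <= k -> minimal_middle f h k = f k.
Proof.
move=> [fg g0 wg [l0 yl0 fgl0] [x1 -> fgx1]] [gh h0 wh [l1 xl1 ghl1] [x2 -> ghx2]] /andP[b2 ba].
set lo := minimal_middle f h.
have [lob _] := weight_minimal_middle a fg gh h0 wh; rewrite -/lo in lob.
have flo k : f k <= lo k by rewrite leq_maxl.
have log k : lo k <= g k by apply: minimal_middle_le.
have close g' l k l' : (forall k, lo k <= g' k) -> (forall k, g' k <= g k) ->
    weight g' = weight f + b -> y <= l -> f l < g' l -> f k < g' k -> k < l' -> g' l' < h l' ->
    exists g' w', step b f y g' w' /\ step a g' w' h x2.+1.
  move=> lo' up wg' yl fgl fgk kl' gh'.
  have [fg' gh''] := hstrip_middle fg gh lo' up.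
  exists g', k.+1; split; split=> //.
  - by move=> j Nj; have := up j; rewrite g0 //; lia.
  - by exists l.
  - by exists k.
  - lia.
  - by exists l'.
  - by exists x2 => //; apply: leq_ltn_trans ghx2.
case: (leqP (weight lo) (weight f)) => [lof|/weight_ltP[k kN flok]].
  (* No cell is forced: one in row [l0] and one in row [x1] are imposed, at most two in all, and
     [2 <= b]. *)
  have [||g' [lo' up wg']] := @weight_between (weight f + b)
      (fun k => maxn (lo k) (f k + ((k == l0) || (k == x1)))) g.
  - move=> k; rewrite geq_max log /=; have [fgk _] := fg k.
    by case: (k =P l0) => [->|_]; [|case: (k =P x1) => [->|_]]; rewrite ?addn0 ?addn1.
  - apply/andP; split; last by lia.
    apply: (@leq_trans (weight (fun k => (lo k + (k == l0) * 1) + (k == x1) * 1))).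
      by apply: weight_le => k; have := flo k; lia.
    rewrite !weight_add.
    by have := weight_pulse_le l0 1; have := weight_pulse_le x1 1; lia.
  left; apply: (close g' l0 x1 l1) => //.
  - by move=> k; have := lo' k; lia.
  - by have := lo' l0; rewrite eqxx; lia.
  - by have := lo' x1; rewrite eqxx orbT; lia.
  - by apply: leq_ltn_trans ghl1.
(* A forced cell in row [k] means [g k.+1 <= f k < h k.+1], so the last two conditions of [close]
   are automatic. *)
have close' g' l : (forall k, lo k <= g' k) -> (forall k, g' k <= g k) ->
    weight g' = weight f + b -> y <= l -> f l < g' l ->
    exists g' w', step b f y g' w' /\ step a g' w' h x2.+1.
  move=> lo' up wg' yl fgl; apply: (close g' l k k.+1) => //.
    exact: leq_trans (lo' k).
  by move: flok; rewrite /lo /minimal_middle; have := up k.+1; have [] := fg k; lia.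
case: (ltngtP (weight lo) (weight f + b)) lob => // [lob _|lob _].
  left; have [||g' [lo' up wg']] := @weight_between (weight f + b)
      (fun k => maxn (lo k) (f k + (k == l0))) g.
  - move=> j; rewrite geq_max log /=; have [fgj _] := fg j.
    by case: (j =P l0) => [->|_]; rewrite ?addn0 ?addn1.
  - apply/andP; split; last by lia.
    apply: (@leq_trans (weight (fun k => (lo k + (k == l0) * 1)))).
      by apply: weight_le => j; have := flo j; lia.
    by rewrite !weight_add; have := weight_pulse_le l0 1; lia.
  apply: (close' g' l0) => //.
    by move=> j; have := lo' j; lia.
  by have := lo' l0; rewrite eqxx; lia.
have [/existsP[l /andP[yl fl]]|none] := boolP [exists l : 'I_N, (y <= l) && (f l < lo l)].
  by left; apply: (close' lo l).
right; split=> // l yl; apply/eqP; rewrite eqn_leq flo andbT leqNgt; apply/negP => fl.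
have lN : l < N by apply: (lt_supp (f := f) _ (leq_trans fl (log l))).
by move: none; rewrite negb_exists => /forallP/(_ (Ordinal lN)) /=; rewrite yl fl.
Qed.

(** Keeping [h] and [z] lets any further strips follow unchanged; [z] survives because every new
    middle shape lies inside [g]. *)
Lemma swap_last_two p a b h z :
  all (leq 2) p -> 2 <= b < a -> (p = [::] \/ a < last 0 p + b) ->
  run (rcons (rcons p a) b) (fun=> 0) 0 h z ->
  run (rcons (rcons p b) a) (fun=> 0) 0 h z.
Proof.
move=> p2 /andP[b2 ba] pab /run_rcons[g [w [/run_rcons[f [y [rp sa]]] sb]]].
have bab : 2 <= b <= a by rewrite b2 ltnW.
have finish f' y' : run p (fun=> 0) 0 f' y' ->
    (exists g' w', step b f' y' g' w' /\ step a g' w' h z) ->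
    run (rcons (rcons p b) a) (fun=> 0) 0 h z.
  move=> rp' [g' [w' [sb' sa']]]; apply/run_rcons; exists g', w'; split=> //.
  by apply/run_rcons; exists f', y'.
have [fg g0 wg _ [x1 wE fgx1]] := sa.
have [gh h0 wh [l1 wl1 ghl1] [x2 zE ghx2]] := sb.
have log k : minimal_middle f h k <= g k by apply: minimal_middle_le.
have flo k : f k <= minimal_middle f h k by rewrite leq_maxl.
have [_ tight] := weight_minimal_middle a fg gh h0 wh.
set lo := minimal_middle f h in log flo tight.
have lo0 k : N <= k -> lo k = 0 by move=> Nk; have := log k; rewrite g0 //; lia.
have [_ loh] := hstrip_middle fg gh (fun=> leqnn _) log; rewrite -/lo in loh.
have dbl : weight lo = weight f + b -> exists k, f k < lo k.
  by move=> wlo; have [|k] := @weight_ltP f lo; [lia|exists k].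
(* Such a row starts a vertical domino of [h / f], with upper cell in [lo / f] and lower cell in
   [h / lo]. *)
have below k : f k < lo k -> f k < h k.+1 /\ lo k.+1 < h k.+1.
  have : f k < lo k -> f k < h k.+1 by rewrite /lo /minimal_middle; lia.
  by move=> fh /fh; have [_] := fg k; have := log k.+1; lia.
case/lastP: p => [|p c] in p2 pab rp finish *.
  case: (exchange_or_tight sa sb bab) => [/(finish _ _ rp)//|[/dbl[k fk] lof]].
  by case: rp lof => _ <- /(_ k isT) E; rewrite /lo E ltnn in fk.
have /andP[c2 {}p2] : (2 <= c) && all (leq 2) p by move: p2; rewrite all_rcons.
have {}pab : a < c + b by case: pab => [|]; rewrite ?last_rcons //; case: (p).
move: rp => /run_rcons[e [y0 [rp sc]]].
have [ef f0 wf low [x0 yE efx0]] := sc.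
have [x efx xmin] : {x | e x < f x & forall k, e k < f k -> x <= k}.
  have ex : exists x, e x < f x by exists x0.
  by case: (ex_minnP ex) => x; exists x.
have above k : k < x -> e k = f k.
  move=> kx; apply/eqP; rewrite eqn_leq (proj1 (ef k)) leqNgt.
  by apply/negP => /xmin; lia.
have {}sc := step_row sc efx.
have xy : x < y by rewrite yE ltnS xmin.
case: (exchange_or_tight (step_low sa xy) sb bab); rewrite -/lo.
  by apply: finish; apply/run_rcons; exists e, y0.
move=> [wlo lof]; have {}tight := tight wlo.
have {}dbl := dbl wlo.
have [/existsP[r fr]|onlyx] := boolP [exists r : 'I_x, f r < lo r].
  have rx := ltn_ord r; have xN := lt_supp f0 efx.
  have [frh _] := below _ fr.
  have wf' : weight (move_cell f r x) = weight f by apply: weight_move; lia.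
  apply: (finish (move_cell f r x) r.+1).
    apply/run_rcons; exists e, y0; split=> //; split.
    - move=> k; have [efk fek] := ef k; rewrite /move_cell; split.
        by case: (k =P x) => [->|]; lia.
      case: (k.+1 =P r) => [kr|]; last by lia.
      rewrite (above k); last by lia.
      have := log r; rewrite -kr in fr *; have [_] := fg k; lia.
    - by move=> k Nk; rewrite /move_cell f0 //; case: (k =P r :> nat); lia.
    - by rewrite wf'.
    (* The bound [y0] may have been met only by the cell lost in row [x]; as [2 <= c], the strip has
       another cell, in row [x] or below. *)
    - case: low => l yl efl.
      have [|k _ kP] := @weight_ltP (fun k => e k + (k == x) * 1) f.
        by rewrite weight_add; have := weight_pulse_le x 1; lia.
      have xk : x <= k by apply: xmin; lia.
      have xl := xmin _ efl.
      case: (l =P x) => [lx|lx]; last first.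
        by exists l => //; rewrite /move_cell; lia.
      exists k; first by lia.
      by rewrite /move_cell; lia.
    - exists r => //; rewrite /move_cell eqxx above //; lia.
  (* As [2 <= b], a forced cell remains in some row [k] once the new [f] has absorbed one in row
     [r]. Row [x], which lost a cell, meets the bound [r.+1]. *)
  have [|k _ kP] := @weight_ltP (fun k => f k + (k == r) * 1) lo.
    by rewrite weight_add wlo; have := weight_pulse_le r 1; lia.
  have fk : f k < lo k by lia.
  have [fhk lohk] := below _ fk.
  exists lo, k.+1; split; split=> //.
  - move=> j; have [fgj gfj] := fg j; rewrite /move_cell; split.
      by have := flo j; case: (j =P r) => [->|]; lia.
    case: (j =P x) => [->|]; last by have := log j.+1; lia.
    by rewrite lof //; have [_] := ef x; lia.
  - by rewrite wf'.
  - by exists x; rewrite ?rx // /move_cell eqxx; have := flo x; lia.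
  - by exists k => //; rewrite /move_cell; lia.
  - by rewrite wlo wh wg; lia.
  - by exists k.+1.
  - by exists x2 => //; apply: leq_ltn_trans ghx2.
have {onlyx dbl} [fx lof'] : f x < lo x /\ forall k, k <> x -> lo k = f k.
  have lof' k : k <> x -> lo k = f k.
    case: (ltngtP k x) => // [kx|/lof//] _.
    move: onlyx; rewrite negb_exists => /forallP/(_ (Ordinal kx)) /=.
    by have := flo k; lia.
  split=> //; case: dbl => k fk; case: (k =P x) => [<-//|/lof'].
  by lia.
have [fhx lohx] := below _ fx.
have xN := lt_supp lo0 fx.
have lox : lo x = f x + b.
  have : weight lo = weight (fun k => f k + (k == x) * (lo x - f x)).
    by apply: eq_bigr => k _; case: ((k : nat) =P x) => [->|/lof' ->]; lia.
  by rewrite weight_add weight_pulse //; lia.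
have gx : g x.+1 = f x by apply: tight; have [_] := fg x; lia.
have fe : f x.+1 <= e x by have [_] := ef x.
(* [g / f] has at least [b] cells in row [x], and [f x - f x.+1] cells in row [x.+1] because
   [g x.+1 = f x]. With [a < c + b] this yields [f x < f x.+1 + c], from which both conditions on
   [c] in [raise_cell] follow. *)
have abig : b + (f x - f x.+1) <= a.
  have x1N : x.+1 < N by apply: (lt_supp h0 (f := g)); rewrite gx.
  suff : weight f + (b + (f x - f x.+1)) <= weight g by rewrite wg leq_add2l.
  rewrite -(weight_pulse b xN) -(weight_pulse (f x - f x.+1) x1N) -!weight_add.
  apply: weight_le => k; have [fgk _] := fg k; have := log x; rewrite lox.
  by case: (k =P x) => [kx|_]; case: (k =P x.+1) => [kx1|_]; rewrite ?kx ?kx1 ?gx; lia.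
have [|||t [xt eft rt]] := raise_cell p2 rp c2 ef f0 wf low above.
- by move=> k kx; have := log x; rewrite lox -kx; have [_] := fg k; lia.
- lia.
- lia.
have tN := lt_supp f0 eft.
have wf' : weight (move_cell f x t) = weight f by apply: weight_move; lia.
(* The cell lost in row [t] meets the bound [x.+1], and [2 <= b] leaves a cell of the new strip in
   row [x]. *)
apply: finish rt _; exists lo, x.+1; split; split=> //.
- move=> k; have [fgk gfk] := fg k; rewrite /move_cell; split.
    by have := flo k; case: (k =P x) => [->|]; lia.
  case: (k =P t) => [->|]; last by have := log k.+1; lia.
  by rewrite lof'; [have [_] := ef t|]; lia.
- by rewrite wf'.
- by exists t => //; rewrite lof' /move_cell ?eqxx; lia.
- by exists x => //; rewrite /move_cell eqxx; lia.
- by rewrite wlo wh wg; lia.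
- by exists x.+1.
- by exists x2 => //; apply: leq_ltn_trans ghx2.
Qed.

Lemma swap_run p a b q h z :
  all (leq 2) p -> 2 <= b < a -> (p = [::] \/ a < last 0 p + b) ->
  run (p ++ [:: a, b & q]) (fun=> 0) 0 h z -> run (p ++ [:: b, a & q]) (fun=> 0) 0 h z.
Proof.
move=> p2 ba pab; rewrite -cat_rcons -[in _ -> _]cat_rcons -cat_rcons -[in _ -> _]cat_rcons.
move=> /run_cat[g [w [r1 r2]]]; apply/run_cat; exists g, w; split=> //.
exact: swap_last_two.
Qed.

(** * Rows of an LR filling as steps of a chain *)

Definition tally (w : seq nat) := fun k => count_mem k.+1 w.

Lemma tally_cat u w k : tally (u ++ w) k = tally u k + tally w k.
Proof. exact: count_cat. Qed.

Lemma weight_tally (w : seq nat) :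
  all (ltn 0) w -> (forall k, N <= k -> tally w k = 0) -> weight (tally w) = size w.
Proof.
elim: w => [|l w IH] /=; first by move=> _ _; rewrite /weight big1.
case/andP=> l0 w0 wN; have lN : l.-1 < N.
  by rewrite ltnNge; apply/negP => /wN; rewrite /tally /= prednK // eqxx.
rewrite -IH // => [|k /wN]; last by rewrite /tally /=; lia.
rewrite -add1n -(weight_pulse 1 lN) -weight_add.
by apply: eq_bigr => k _; rewrite /tally /=; lia.
Qed.

Lemma word_of_tally f : (forall k, N <= k -> f k = 0) ->
  exists w : seq nat, [/\ sorted geq w, all (ltn 0) w & tally w =1 f].
Proof.
move=> f0.
suff [w [w0 wf]] : exists w : seq nat,
    all (ltn 0) w /\ forall k, tally w k = if k < N then f k else 0.
  exists (sort geq w); split.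
  - by apply: sort_sorted => m n; apply: leq_total.
  - by rewrite all_sort.
  - by move=> k; rewrite /tally count_sort; have := wf k; rewrite /tally => ->; case: ltnP => // /f0.
elim: N => [|n [w [w0 wf]]]; first by exists [::].
exists (nseq (f n) n.+1 ++ w); rewrite all_cat w0 andbT; split.
  by apply/allP => k /nseqP[->].
move=> k; rewrite tally_cat wf /tally count_nseq /= eqSS ltnS.
by case: (ltngtP k n) => [||->]; rewrite ?mul0n ?mul1n ?addn0.
Qed.

(* As [last 0 [::] = 0], [ascends [::] w] only asks for a positive first letter. *)
Definition ascends (u w : seq nat) := last 0 u < head 0 w.

(** Rows are kept as read, right to left: the last letter of a row sits directly above the first
    letter of the next. [u] is the row preceding [ws]. *)
Definition ribbon_rows (u : seq nat) (ws : seq (seq nat)) :=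
  [/\ path ascends u ws, all (sorted geq) ws & all (all (ltn 0)) ws].

Lemma sorted_geq_head w l : sorted geq w -> l \in w -> l <= head 0 w.
Proof.
case: w => //= a w; rewrite path_sortedE; last by move=> ? ? ? /= h1 h2; apply: leq_trans h2 h1.
by case/andP=> /allP aw _; rewrite in_cons => /orP[/eqP->//|/aw].
Qed.

Lemma sorted_geq_last w l : sorted geq w -> l \in w -> last 0 w <= l.
Proof.
elim/last_ind: w => // w a _; rewrite last_rcons -rev_sorted rev_rcons /=.
rewrite path_sortedE; last by move=> ? ? ? /=; apply: leq_trans.
case/andP=> /allP aw _; rewrite mem_rcons in_cons -mem_rev => /orP[/eqP->//|/aw].
by [].
Qed.

Lemma take_count_geq w m :
  sorted geq w -> take (count (leq m) w) w = filter (leq m) w.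
Proof.
elim: w => //= a w IH aw; rewrite -(IH (path_sorted aw)).
case: (leqP m a) => [//|am]; rewrite add0n.
rewrite (_ : count _ w = 0) ?take0 //; apply/eqP; rewrite -leqn0 leqNgt -has_count.
apply/hasPn => l lw; rewrite -ltnNge; apply: leq_ltn_trans am.
by apply: (@sorted_geq_head (a :: w)); rewrite ?in_cons ?lw ?orbT.
Qed.

(** As [w] is weakly decreasing, the prefix ending after its letters [>= k.+2] has all its letters
    [k.+2] and none of its [k.+1]. The result is the horizontal strip inequality. *)
Lemma yamanouchi_sorted_cat pre w k : sorted geq w -> yamanouchi (pre ++ w) ->
  tally pre k.+1 + tally w k.+1 <= tally pre k.
Proof.
move=> sw /(_ (size pre + count (leq k.+2) w) k.+1 isT).
rewrite take_cat ltnNge leq_addr /= addKn take_count_geq // !count_cat !count_filter.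
rewrite (eq_count (a1 := predI _ _) (a2 := pred1 k.+2)) => [|l /=]; last first.
  by case: eqP => // ->; rewrite leqnn.
rewrite (eq_count (a1 := predI (pred1 k.+1) _) (a2 := pred0)) => [|l /=].
  by rewrite count_pred0 addn0.
by case: eqP => // ->; rewrite ltnn.
Qed.

Lemma yamanouchi_take n w : yamanouchi w -> yamanouchi (take n w).
Proof. by move=> yam m; rewrite -take_min; apply: yam. Qed.

(** Letter [k.+1] is a cell in row [k], so the last letter of a row is itself the bound passed on,
    and the first letter of the next row meets it. *)
Lemma run_of_rows pre u ws :
  ribbon_rows u ws -> yamanouchi (pre ++ flatten ws) ->
  (forall k, N <= k -> tally (pre ++ flatten ws) k = 0) ->
  exists g z, run [seq size w | w <- ws] (tally pre) (last 0 u) g z /\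
              g =1 tally (pre ++ flatten ws).
Proof.
elim: ws pre u => [|w ws IH] pre u.
  by move=> _ _ _; exists (tally pre), (last 0 u); rewrite /= cats0.
case=> /= /andP[uw wws] /andP[sw sws] /andP[w0 ws0]; rewrite catA => yam supp.
have [g [z [r gE]]] := IH (pre ++ w) w (And3 wws sws ws0) yam supp.
have suppw k : N <= k -> tally pre k + tally w k = 0.
  by move=> /supp; rewrite !tally_cat; lia.
exists g, z; split=> //; exists (tally (pre ++ w)), (last 0 w); split=> //.
have memlt l : l \in w -> tally pre l.-1 < tally (pre ++ w) l.-1.
  move=> lw; have l0 := allP w0 _ lw.
  by rewrite tally_cat -addn1 leq_add2l /tally prednK // -has_count has_pred1.
have [a [w' wE]] : exists a w', w = a :: w'.
  by move: uw; rewrite /ascends; case: (w) => // a w'; exists a, w'.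
split.
- move=> k; rewrite !tally_cat; split; first exact: leq_addr.
  apply: yamanouchi_sorted_cat => //.
  by have := @yamanouchi_take (size (pre ++ w)) _ yam; rewrite take_size_cat.
- by move=> k; rewrite tally_cat; apply: suppw.
- rewrite -weight_tally // => [|k /suppw]; last by lia.
  by rewrite -weight_add; apply: eq_bigr => k _; rewrite tally_cat.
- exists (head 0 w).-1; first by move: uw; rewrite /ascends; lia.
  by apply: memlt; rewrite wE mem_head.
- have lw : last 0 w \in w by rewrite wE /= mem_last.
  exists (last 0 w).-1; last exact: memlt.
  by rewrite prednK //; apply: (allP w0).
Qed.

(** A step may record any row of its strip, while the word built for it ends in its smallest letter;
    hence only [last 0 u <= y]. *)
Lemma rows_of_run p f g z pre u y :
  f =1 tally pre -> yamanouchi pre -> last 0 u <= y -> run p f y g z ->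
  exists ws, [/\ [seq size w | w <- ws] = p, ribbon_rows u ws,
    tally (pre ++ flatten ws) =1 g & yamanouchi (pre ++ flatten ws)].
Proof.
elim: p f y pre u => [|a p IH] f y pre u fE yam uy.
  by case=> <- _; exists [::]; rewrite /= cats0; split.
case=> h [x [[fh h0 wh [l yl fhl] [x1 xE fhx]] r]].
have [|v [sv v0 vE]] := @word_of_tally (fun k => h k - f k).
  by move=> k /h0 ->.
have mem k : f k < h k -> k.+1 \in v.
  by move=> fhk; rewrite -has_pred1 has_count -[count _ _]/(tally v k) vE; lia.
have hE : h =1 tally (pre ++ v).
  by move=> k; rewrite tally_cat vE -fE; have [] := fh k; lia.
have [||ws [wsp [pw sw w0] tw yw]] := IH h x (pre ++ v) v hE _ _ r.
- move=> n [//|k] _; rewrite take_cat; case: ltnP => [_|np]; first exact: yam.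
  rewrite !count_cat; have [_ hf] := fh k; move: hf; rewrite fE hE tally_cat.
  have := count_cat (pred1 k.+2) (take (n - size pre) v) (drop (n - size pre) v).
  by rewrite cat_take_drop /tally; lia.
- by rewrite xE; apply: sorted_geq_last => //; apply: mem.
exists (v :: ws); rewrite /= catA; split=> //.
  rewrite wsp -weight_tally // => [|k Nk]; last by rewrite vE h0.
  congr (_ :: _); apply/eqP; rewrite -(eqn_add2l (weight f)) -wh -weight_add.
  by apply/eqP; apply: eq_bigr => k _; rewrite vE; have [] := fh k; lia.
rewrite /ribbon_rows /= pw sv sw v0 w0 /ascends !andbT; split=> //.
by apply: leq_ltn_trans uy (leq_trans _ (sorted_geq_head sv (mem _ fhl))).
Qed.
End Chains.

(** * Fillings of a ribbon as lists of rows *)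

Lemma map_rev_iota (F : nat -> nat) m n :
  [seq F c | c <- rev (iota m n)] = mkseq (fun j => F (m + n - j.+1)) n.
Proof.
apply: (@eq_from_nth _ 0) => [|j]; first by rewrite size_map size_rev size_iota size_mkseq.
rewrite size_map size_rev size_iota => jn.
rewrite nth_mkseq // (nth_map 0) ?size_rev ?size_iota // nth_rev ?size_iota //.
by rewrite nth_iota; [congr F|]; lia.
Qed.

Section Ribbon.
Variable alpha : seq nat.
Hypothesis alpha_gt0 : all (ltn 0) alpha.
Let m := size alpha.
Let outer r := nth 0 (ribbon_outer alpha) r.
Let inner r := nth 0 (ribbon_inner alpha) r.

(** Ensures that the subtractions in [ribbon_outer] and [ribbon_inner] do not truncate. *)
Lemma sumn_drop_ge r : m - r <= sumn (drop r alpha).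
Proof.
rewrite /m -size_drop; have : all (ltn 0) (drop r alpha).
  by apply/allP => a /mem_drop /(allP alpha_gt0).
by elim: (drop r alpha) => //= a s IH /andP[a0 /IH]; lia.
Qed.

Lemma ribbon_row_width r : r < m -> outer r = inner r + nth 0 alpha r.
Proof.
move=> rm; rewrite /outer /inner !(nth_map 0) ?size_iota // nth_iota // add0n.
by rewrite (drop_nth 0) //=; have := sumn_drop_ge r.+1; rewrite /m; lia.
Qed.

Lemma ribbon_rows_meet r : r.+1 < m -> outer r.+1 = (inner r).+1.
Proof.
move=> rm; rewrite /outer /inner !(nth_map 0) ?size_iota // ?nth_iota // ?add0n; try lia.
by have := sumn_drop_ge r.+1; rewrite /m in rm *; lia.
Qed.

Lemma in_ribbon_lt r c : in_skew (ribbon_outer alpha) (ribbon_inner alpha) r c -> r < m.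
Proof.
case/andP => _; case: (ltnP r m) => // mr.
by rewrite nth_default // size_map size_iota.
Qed.

Definition ribbon_row (T : nat -> nat -> nat) r :=
  mkseq (fun j => T r (outer r - j.+1)) (nth 0 alpha r).

Lemma rev_reading_word_ribbon T :
  rev_reading_word (ribbon_outer alpha) (ribbon_inner alpha) T =
  flatten (mkseq (ribbon_row T) m).
Proof.
rewrite /rev_reading_word size_map size_iota; congr flatten.
apply/eq_in_map => r; rewrite mem_iota add0n => /= rm.
rewrite map_rev_iota -/(outer r) -/(inner r) /ribbon_row ribbon_row_width //.
by rewrite addKn.
Qed.

Lemma ribbon_supportP nu : ribbon_support alpha nu <->
  is_partition nu /\ exists ws, [/\ [seq size w | w <- ws] = alpha,
    ribbon_rows [::] ws, has_content (flatten ws) nu & yamanouchi (flatten ws)].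
Proof.
split=> [] [pnu].
  case=> T [[T0 [Tr Tc]]]; rewrite rev_reading_word_ribbon => -[cT yT].
  split=> //; exists (mkseq (ribbon_row T) m); split=> //.
    apply: (@eq_from_nth _ 0); rewrite !size_map size_iota // => r rm.
    by rewrite (nth_map [::]) ?size_mkseq // nth_mkseq // size_mkseq.
  have a0 r : r < m -> 0 < nth 0 alpha r by move=> rm; apply: (allP alpha_gt0); apply: mem_nth.
  have cell r j : r < m -> j < nth 0 alpha r ->
      in_skew (ribbon_outer alpha) (ribbon_inner alpha) r (outer r - j.+1).
    move=> rm jr; rewrite /in_skew -/(outer r) -/(inner r); have := ribbon_row_width rm; lia.
  split.
  - apply/(pathP [::]) => r; rewrite size_mkseq => rm; rewrite /ascends nth_mkseq //.
    rewrite -[head _ _]nth0 nth_mkseq ?a0 //.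
    case: r rm => [|r] rm /=; first by apply: T0; apply: cell; rewrite ?a0.
    have rm' : r < m by apply: ltnW.
    rewrite nth_mkseq // -nth_last size_mkseq nth_mkseq; last by rewrite prednK ?a0.
    (* The last letter of row [r] and the first of row [r.+1] share column [inner r]. *)
    have E : outer r - (nth 0 alpha r).-1.+1 = inner r.
      by rewrite prednK ?a0 // ribbon_row_width // addnK.
    have E' : outer r.+1 - 1 = inner r by rewrite ribbon_rows_meet // subn1.
    rewrite E E'; apply: Tc.
      by rewrite -E; apply: cell; rewrite ?prednK ?a0.
    by rewrite -E'; apply: cell; rewrite ?a0.
  - apply/allP => _ /mapP[r rm ->]; rewrite mem_iota in rm.
    apply/(sortedP 0) => j; rewrite size_mkseq => jr; rewrite !nth_mkseq //; last exact: ltnW.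
    have E : outer r - j.+1 = (outer r - j.+2).+1 by have := ribbon_row_width rm; lia.
    by rewrite /geq /= E; apply: Tr; rewrite -?E; apply: cell => //; apply: ltnW.
  - apply/allP => _ /mapP[r rm ->]; apply/allP => _ /mapP[j jr ->].
    by rewrite !mem_iota in rm jr; apply: T0; apply: cell.
case=> ws [wsa [pw sw w0] cw yw]; split=> //.
pose T r c := nth 0 (nth [::] ws r) (outer r - c.+1).
have sws : size ws = m by rewrite -(size_map size) wsa.
have sw_r r : r < m -> size (nth [::] ws r) = nth 0 alpha r.
  by move=> rm; rewrite -wsa (nth_map [::]) ?sws.
have mem_ws r : r < m -> nth [::] ws r \in ws by move=> rm; rewrite mem_nth ?sws.
have rowE : mkseq (ribbon_row T) m = ws.
  apply: (@eq_from_nth _ [::]); rewrite size_mkseq // => r rm; rewrite nth_mkseq //.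
  apply: (@eq_from_nth _ 0); rewrite size_mkseq ?sw_r // => j jr; rewrite nth_mkseq //.
  by rewrite /T; congr nth; have := ribbon_row_width rm; lia.
exists T; rewrite rev_reading_word_ribbon rowE; split=> //.
have col r c : in_skew (ribbon_outer alpha) (ribbon_inner alpha) r c ->
    [/\ r < m, inner r <= c < outer r & outer r - c.+1 < size (nth [::] ws r)].
  move=> rc; have rm := in_ribbon_lt rc; rewrite sw_r //; split=> //.
  by move: rc; rewrite /in_skew -/(inner r) -/(outer r) ribbon_row_width //; lia.
split; [|split] => [r c /col[rm _ jr]|r c /col[rm _ jr] /col[_ cr jr']|r c].
- by apply: (allP (allP w0 _ (mem_ws r rm))); apply: mem_nth.
- have /(sortedP 0)/(_ (outer r - c.+2)) := allP sw _ (mem_ws r rm).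
  by rewrite /T (_ : (outer r - c.+2).+1 = outer r - c.+1); [apply|lia].
move=> /col[rm rc jr] /col[rm' rc' jr'].
have cE : c = inner r by move: rc'; rewrite ribbon_rows_meet //; lia.
move/(pathP [::]): pw => /(_ r.+1); rewrite sws /ascends /= => /(_ rm').
rewrite -nth0 -nth_last /T sw_r // (ribbon_rows_meet rm') cE subnn.
by rewrite (_ : outer r - _ = (nth 0 alpha r).-1) // ribbon_row_width //; lia.
Qed.
End Ribbon.

(** * The exchange for compositions *)

Lemma swap_adj_cat p a b q : swap_adj (p ++ [:: a, b & q]) (size p).+1 = p ++ [:: b, a & q].
Proof.
rewrite /swap_adj /= !nth_cat ltnn subnn ltnNge leqnSn subSnn /=.
by elim: p => //= x p ->.
Qed.

(* i is 1-indexed as in the paper: alpha_i = nth 0 alpha i.-1.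
   alpha_0 = infinity, so the second inequality is vacuous when i = 1. *)
Theorem theorem3p3 (alpha : seq nat) (i : nat) :
  3 <= size alpha ->
  all (fun a => 2 <= a) alpha ->
  1 <= i <= size alpha - 1 ->
  nth 0 alpha i < nth 0 alpha i.-1 ->
  (i == 1) || (nth 0 alpha i.-1 < nth 0 alpha i.-2 + nth 0 alpha i) ->
  forall nu : seq nat, ribbon_support alpha nu -> ribbon_support (swap_adj alpha i) nu.
Proof.
move=> _ a2 /andP[i1 im].
have [p [a [b [q [alphaE ->]]]]] : exists p a b q, alpha = p ++ [:: a, b & q] /\ i = (size p).+1.
  exists (take i.-1 alpha), (nth 0 alpha i.-1), (nth 0 alpha i), (drop i.+1 alpha).
  case: i i1 im => //= i _ im; have il : i.+1 < size alpha by lia.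
  by rewrite -(drop_nth 0 il) -(drop_nth 0 (ltnW il)) cat_take_drop size_takel ?(ltnW (ltnW il)).
rewrite {i i1 im alpha}alphaE in a2 *.
have pp : ((size p).+1 < size p) = false by lia.
rewrite swap_adj_cat /= !nth_cat ltnn subnn pp subSnn /= => ba pab nu.
have [p2 b2] : all (leq 2) p /\ 2 <= b by move: a2; rewrite all_cat /= => /and4P[].
have pos1 : all (ltn 0) (p ++ [:: a, b & q]) by apply: sub_all a2 => x /ltnW.
have pos2 : all (ltn 0) (p ++ [:: b, a & q]).
  by move: pos1; rewrite !all_cat /= => /and4P[-> -> -> ->].
move=> /(ribbon_supportP pos1)[pnu [ws [wsp rws cws yws]]]; apply/(ribbon_supportP pos2).
split=> //.
(* No letter exceeds [size nu], so this many rows suffice. *)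
have [|g [z [r gE]]] := @run_of_rows (size nu) [::] [::] ws rws yws.
  by move=> k nuk; rewrite /= /tally cws nth_default.
have r' : run (size nu) (p ++ [:: b, a & q]) (fun=> 0) 0 g z.
  apply: swap_run; [by []|by rewrite b2| |by rewrite -wsp].
  case/lastP: (p) pab => [|p' c]; first by left.
  by rewrite size_rcons /= last_rcons nth_rcons ltnn eqxx ltnSn; right.
have yam0 : yamanouchi [::] by [].
have [ws' [ws'p rws' cws' yws']] := rows_of_run (u := [::]) (fun=> erefl) yam0 (leqnn 0) r'.
exists ws'; split=> // k; rewrite -cws.
by have := cws' k; rewrite gE.
Qed.
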